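(* For real numbers $s,t$ let $R(s,t)\subset\mathbb{R}^5$ be the simplex with vertices $$\left(s,1,\tfrac13,1,1\right),\ \left(s,0,\tfrac13,1,1\right),\ \left(s,2-3t,\tfrac13,0,1\right),\ \left(2-3s,t,0,\tfrac13,0\right),\ \left(0,t,1,\tfrac13,0\right),\ \left(1,t,1,\tfrac13,0\right).$$ If $\frac49\le s\le\frac59$ and $\frac49\le t\le\frac59$, then $R(s,t)$ is a nondegenerate simplex with $R(s,t)\subset Q_5\subset 5R(s,t)$, $\xi(R(s,t))=\xi_5=5$, the simplex $5R(s,t)$ is circumscribed around $Q_5$, and every vertex of $Q_5$ belongs to the boundary of $5R(s,t)$; that is, $R(s,t)$ is a perfect simplex.
   Context: $Q_n=[0,1]^n\subset\mathbb{R}^n$. For a nondegenerate $n$-dimensional simplex $S\subset\mathbb{R}^n$ and $\sigma>0$, $\sigma S$ denotes the image of $S$ under the homothety with center at the center of gravity of $S$ (the arithmetic mean of its vertices) and coefficient $\sigma$. Put $\xi(S)=\min\{\sigma\ge 1: Q_n\subset\sigma S\}$, and $$\xi_n=\min\{\xi(S): S \text{ is an } n\text{-dimensional simplex},\ S\subset Q_n,\ \mathrm{vol}(S)\neq 0\}.$$ An $n$-dimensional simplex $T$ is circumscribed around a convex body $C$ if $C\subset T$ and each $(n-1)$-dimensional face of $T$ contains a point of $C$. A nondegenerate simplex $S\subset\mathbb{R}^n$ is called perfect if $S\subset Q_n\subset\xi_nS$ and the boundary of $\xi_nS$ contains all the vertices of $Q_n$. *)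

(* Defs.v *)
From HB Require Import structures.
From mathcomp Require Import all_boot all_order all_algebra.
From mathcomp Require Import all_classical all_reals all_analysis.

Set Implicit Arguments.
Unset Strict Implicit.
Unset Printing Implicit Defensive.

Import Order.TTheory GRing.Theory Num.Theory.
Import numFieldNormedType.Exports.

Local Open Scope classical_set_scope.
Local Open Scope ring_scope.

(* A simplex of R^n is given by the family v : 'I_n.+1 -> 'rV[R]_n of its
   n + 1 vertices; [simplex v] is the corresponding point set. *)

Section Simplices.
Variables (R : realType) (n : nat).
Implicit Types (v : 'I_n.+1 -> 'rV[R]_n) (A C T : set 'rV[R]_n).

Definition cube : set 'rV[R]_n :=
  [set x | forall j : 'I_n, 0 <= x ord0 j <= 1].

Definition cube_vertices : set 'rV[R]_n :=
  [set x | forall j : 'I_n, x ord0 j = 0 \/ x ord0 j = 1].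

Definition barycentric (a : 'I_n.+1 -> R) : Prop :=
  (forall i, 0 <= a i) /\ \sum_i a i = 1.

Definition simplex v : set 'rV[R]_n :=
  [set x | exists2 a, barycentric a & x = \sum_i a i *: v i].

(* The (n-1)-dimensional face of the simplex opposite to the vertex v j. *)
Definition simplex_face v (j : 'I_n.+1) : set 'rV[R]_n :=
  [set x | exists2 a, barycentric a /\ a j = 0 & x = \sum_i a i *: v i].

(* Affine independence of the vertices. *)
Definition nondegenerate_simplex v : Prop :=
  forall a : 'I_n.+1 -> R,
    \sum_i a i = 0 -> \sum_i a i *: v i = 0 -> forall i, a i = 0.

(* n-dimensional volume of the simplex: |det(v_1 - v_0, ..., v_n - v_0)| / n! *)
Definition simplex_vol v : R :=
  `|\det (\matrix_(i < n) (v (lift ord0 i) - v ord0))| / n`!%:R.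

Definition centroid v : 'rV[R]_n := n.+1%:R^-1 *: \sum_i v i.

Definition homothety (c : 'rV[R]_n) (sigma : R) (x : 'rV[R]_n) : 'rV[R]_n :=
  c + sigma *: (x - c).

(* The set sigma S. *)
Definition dilate (sigma : R) v : set 'rV[R]_n :=
  homothety (centroid v) sigma @` simplex v.

Definition boundary A : set 'rV[R]_n := closure A `\` interior A.

Definition circumscribed T C : Prop :=
  exists w : 'I_n.+1 -> 'rV[R]_n,
    [/\ nondegenerate_simplex w, T = simplex w, C `<=` T
      & forall j, simplex_face w j `&` C !=set0].

(* The minimum of a set of reals, with the default value 0 when there is no
   minimum. As [xi v] below is at least 1 whenever its minimum exists, a
   nonzero value of [xi v] or [xi_min] witnesses that the minimum is attained. *)
Definition set_min (A : set R) : R :=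
  xget 0 [set m | A m /\ lbound A m].

Definition xi v : R :=
  set_min [set sigma | 1 <= sigma /\ cube `<=` dilate sigma v].

Definition xi_min : R :=
  set_min [set x | exists v, [/\ nondegenerate_simplex v, simplex v `<=` cube,
                                 simplex_vol v != 0 & x = xi v]].

Definition perfect_simplex v : Prop :=
  [/\ nondegenerate_simplex v, simplex v `<=` cube, cube `<=` dilate xi_min v
    & cube_vertices `<=` boundary (dilate xi_min v)].

End Simplices.

Arguments cube R n : clear implicits.
Arguments cube_vertices R n : clear implicits.
Arguments xi_min R n : clear implicits.

(* The family of vertices of the simplex R(s, t) of R^5. *)
Definition simplexR (R : realType) (s t : R) (i : 'I_6) : 'rV[R]_5 :=
  \row_(j < 5) (nth [::]
    [:: [:: s;         1;         1 / 3; 1;     1];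
        [:: s;         0;         1 / 3; 1;     1];
        [:: s;         2 - 3 * t; 1 / 3; 0;     1];
        [:: 2 - 3 * s; t;         0;     1 / 3; 0];
        [:: 0;         t;         1;     1 / 3; 0];
        [:: 1;         t;         1;     1 / 3; 0]] i)`_j.

(* Main.v *)
Require Import Defs.
From HB Require Import structures.
From mathcomp Require Import all_boot all_order all_algebra.
From mathcomp Require Import all_classical all_reals all_analysis.
From mathcomp Require Import ring lra.

(** For a nondegenerate simplex [v] let [bary v x k] be the barycentric
coordinates of a point [x]. Since a homothety centred at the centroid moves
every coordinate affinely away from [1 / (n + 1)], the set [dilate sigma v]
consists of the points all of whose coordinates are at least
[(1 - sigma) / (n + 1)] ([dilate_baryP]). Everything is read off from this
description.

The lower bound [n <= xi v] for a simplex inside the cube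
([dilation_coef_ge]): the minimum over the cube of the affine function
[bary v x k] is its value at the centre of the cube minus half the l1-norm of
its gradient. If the cube lies in [dilate sigma v], each of these [n + 1] minima
is at least [(1 - sigma) / (n + 1)]; the coordinates of the centre add up to 1,
so summing over [k] gives [2 sigma >= \sum_i \sum_k `|slope v i k|]. For
each axis [i] the inner sum is at least 2 ([slope_norm_sum]): the slopes add up
to 0 and express the unit vector of the axis as a combination of the vertices,
whose [i]-th coordinates range over an interval of length at most 1. Hence
[sigma >= n], and a simplex in the cube whose [n]-fold dilation covers the cube
realizes [xi_min] ([xi_min_eq]).

For the simplex [simplexR s t] the barycentric coordinates are explicit
([bary_simplexR]). On the cube each of them has minimum exactly [- 2 / 3], which
is [(1 - 5) / 6]: the slope signs that decide where the minimum is taken are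
constant for [s] and [t] between [4 / 9] and [5 / 9], the critical factors being
[3 s - 4 / 3] and [5 / 3 - 3 s] and their analogues in [t]. Each vertex of the
cube lies on one of the faces where the minimum is taken
([cube_vertex_facet]), hence in the boundary of the dilated simplex. *)

Set Implicit Arguments.
Unset Strict Implicit.
Unset Printing Implicit Defensive.

Import Order.TTheory GRing.Theory Num.Theory.
Import numFieldNormedType.Exports.

Local Open Scope classical_set_scope.
Local Open Scope ring_scope.

(** * Barycentric coordinates and dilations *)

Section Barycentric.
Variables (R : realType) (n : nat).
Implicit Types (v : 'I_n.+1 -> 'rV[R]_n) (a : 'I_n.+1 -> R) (x : 'rV[R]_n).

(** A leading 1 is put before each vertex, so that a linear combination of the
rows records the sum of its coefficients as well as the resulting point;
barycentric coordinates are then obtained by inverting this matrix. *)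
Definition vertex_mx v : 'M[R]_(1 + n) :=
  \matrix_(k < 1 + n) row_mx (1 : 'rV[R]_1) (v k).

Definition bary v x (k : 'I_n.+1) : R :=
  (row_mx (1 : 'rV[R]_1) x *m invmx (vertex_mx v)) ord0 k.

(** The partial derivative of [bary v x k] in the direction of the [i]-th axis
(see [baryE]): row 0 of the inverse matrix holds the constant terms, the
remaining rows the gradients. *)
Definition slope v (i : 'I_n) (k : 'I_n.+1) : R :=
  invmx (vertex_mx v) (rshift 1 i) k.

Lemma mul_vertex_mx v (u : 'rV[R]_(1 + n)) :
  u *m vertex_mx v =
  row_mx (\sum_k u ord0 k)%:M (\sum_(k < 1 + n) u ord0 k *: v k).
Proof.
rewrite mulmx_sum_row (eq_bigr (fun k => row_mx (u ord0 k)%:M (u ord0 k *: v k))).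
  apply/rowP => j; rewrite summxE; case: (splitP j) => i ji.
    have -> : j = lshift n i by apply: val_inj.
    rewrite row_mxEl (ord1 i) !mxE eqxx mulr1n; apply: eq_bigr => k _.
    by rewrite row_mxEl !mxE eqxx mulr1n.
  have -> : j = rshift 1 i by apply: val_inj.
  rewrite row_mxEr !summxE; apply: eq_bigr => k _.
  by rewrite row_mxEr.
by move=> k _; rewrite rowK scale_row_mx; congr row_mx; rewrite scalemx1.
Qed.

Lemma vertex_mx_unit v : nondegenerate_simplex v -> vertex_mx v \in unitmx.
Proof.
move=> nd; rewrite -row_free_unit; apply/inj_row_free => u.
rewrite mul_vertex_mx => uM.
have [u0 u1] := eq_row_mx (etrans uM (esym (row_mx0 _ _ _ _))).
apply/rowP => k; rewrite mxE; apply: (nd (u ord0)) => //.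
by move/matrixP: u0 => /(_ ord0 ord0); rewrite !mxE eqxx !mulr1n.
Qed.

Lemma bary_spec v x : nondegenerate_simplex v ->
  \sum_k bary v x k = 1 /\ \sum_k bary v x k *: v k = x.
Proof.
move=> nd; have := mul_vertex_mx v (row_mx 1 x *m invmx (vertex_mx v)).
rewrite mulmxKV ?vertex_mx_unit // => /eq_row_mx[e1 e2]; split; last by rewrite [RHS]e2.
by move/matrixP: e1 => /(_ ord0 ord0); rewrite !mxE eqxx !mulr1n.
Qed.

Lemma bary_unique v a x : nondegenerate_simplex v ->
  \sum_k a k = 1 -> x = \sum_k a k *: v k -> a =1 bary v x.
Proof.
move=> nd a1 ->; have [b1 b2] := bary_spec (\sum_k a k *: v k) nd => k.
apply/eqP; rewrite -subr_eq0; apply/eqP.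
apply: (nd (fun k => a k - bary v (\sum_k a k *: v k) k)).
  by rewrite sumrB a1 b1 subrr.
by rewrite (eq_bigr _ (fun k _ => scalerBl _ _ _)) sumrB b2 subrr.
Qed.

Lemma baryE v x k :
  bary v x k = bary v 0 k + \sum_i x ord0 i * slope v i k.
Proof.
rewrite /bary !mxE !big_split_ord /= !big_ord1 !row_mxEl.
rewrite [\sum_(i < n) row_mx _ 0 _ _ * _]big1 ?addr0; last first.
  by move=> i _; rewrite row_mxEr mxE mul0r.
by congr (_ + _); apply: eq_bigr => i _; rewrite row_mxEr.
Qed.

Lemma bary_delta v i k : bary v (delta_mx ord0 i) k = bary v 0 k + slope v i k.
Proof.
rewrite baryE (bigD1 i) //= mxE !eqxx mul1r big1 ?addr0 // => j ji.
by rewrite mxE (negbTE ji) andbF mul0r.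
Qed.

Lemma slope_sum v i : nondegenerate_simplex v -> \sum_k slope v i k = 0.
Proof.
move=> nd; have [+ _] := bary_spec (delta_mx ord0 i) nd.
under eq_bigr do rewrite bary_delta.
rewrite big_split /= (bary_spec 0 nd).1 => /(canRL (addKr 1)).
by rewrite addNr.
Qed.

Lemma slope_comb v i : nondegenerate_simplex v ->
  \sum_k slope v i k *: v k = delta_mx ord0 i.
Proof.
move=> nd; rewrite -(bary_spec (delta_mx ord0 i) nd).2.
under [RHS]eq_bigr do rewrite bary_delta scalerDl.
by rewrite big_split /= (bary_spec 0 nd).2 add0r.
Qed.

Lemma vertex_in_simplex v k : simplex v (v k).
Proof.
exists (fun i => (i == k)%:R).
  split=> [i|]; first by rewrite ler0n.
  by rewrite (bigD1 k) //= eqxx big1 ?addr0 // => i /negbTE ->.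
by rewrite (bigD1 k) //= eqxx scale1r big1 ?addr0 // => i /negbTE ->; rewrite scale0r.
Qed.

(** A row vector killing the matrix of edge vectors at [v ord0] becomes an affine
dependence once [v ord0] gets minus the sum of its entries. *)
Lemma simplex_vol_neq0 v : nondegenerate_simplex v -> simplex_vol v != 0.
Proof.
move=> nd; rewrite /simplex_vol mulf_eq0 invr_eq0 pnatr_eq0 eqn0Ngt fact_gt0 orbF.
rewrite normr_eq0; apply/negP => /det0P[u /negP u0] u1; apply: u0.
pose a (k : 'I_n.+1) := if unlift ord0 k is Some i then u ord0 i
                        else - \sum_i u ord0 i.
have a0 : a ord0 = - \sum_i u ord0 i by rewrite /a unlift_none.
have aS (i : 'I_n) : a (lift ord0 i) = u ord0 i by rewrite /a liftK.
have az : forall k, a k = 0.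
  apply: nd; rewrite big_ord_recl a0.
    by (under [X in _ + X]eq_bigr do rewrite aS); rewrite addNr.
  move: u1; rewrite mulmx_sum_row; under eq_bigr do rewrite rowK scalerBr.
  rewrite sumrB -scaler_suml => u1.
  by (under [X in _ + X]eq_bigr do rewrite aS); rewrite scaleNr addrC.
by apply/eqP/rowP => i; rewrite -aS az mxE.
Qed.

(** The effect of a homothety with centre the centroid on the coefficients of
an affine combination of the vertices (see [homothety_comb]): the centroid has
all its coefficients equal to [1 / (n + 1)]. *)
Definition scale_coef (sigma : R) a (k : 'I_n.+1) : R :=
  n.+1%:R^-1 + sigma * (a k - n.+1%:R^-1).

Lemma sum_inv_card : \sum_(k < n.+1) n.+1%:R^-1 = 1 :> R.
Proof. by rewrite sumr_const card_ord -[LHS]mulr_natl divff ?pnatr_eq0. Qed.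

Lemma scale_coef_sum sigma a :
  \sum_k a k = 1 -> \sum_k scale_coef sigma a k = 1.
Proof.
move=> a1; rewrite big_split /= sum_inv_card -mulr_sumr sumrB a1.
by rewrite sum_inv_card subrr mulr0 addr0.
Qed.

Lemma homothety_comb sigma v a :
  homothety (centroid v) sigma (\sum_k a k *: v k) =
  \sum_k scale_coef sigma a k *: v k.
Proof.
rewrite /homothety /centroid scaler_sumr -sumrB scaler_sumr -big_split /=.
by apply: eq_bigr => k _; rewrite -scalerBl scalerA -scalerDl.
Qed.

Lemma comb_homothety c sigma v a : \sum_k a k = 1 ->
  \sum_k a k *: homothety c sigma (v k) = homothety c sigma (\sum_k a k *: v k).
Proof.
move=> a1; rewrite /homothety; under eq_bigr do rewrite scalerDr scalerA mulrC -scalerA.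
rewrite big_split /= -scaler_suml a1 scale1r -scaler_sumr; congr (_ + _ *: _).
under [LHS]eq_bigr do rewrite scalerBr.
by rewrite sumrB -scaler_suml a1 scale1r.
Qed.

Lemma scale_coefK sigma a k : sigma != 0 ->
  scale_coef sigma (scale_coef sigma^-1 a) k = a k.
Proof.
move=> s0; rewrite /scale_coef [_ + _ - _]addrC addKr mulrA divff // mul1r.
by rewrite addrC subrK.
Qed.

Lemma scale_coef_ge sigma a k : 0 < sigma ->
  ((1 - sigma) / n.+1%:R <= scale_coef sigma a k) = (0 <= a k).
Proof.
move=> s0; rewrite -subr_ge0 [X in 0 <= X](_ : _ = sigma * a k).
  by rewrite pmulr_rge0.
by rewrite /scale_coef; ring.
Qed.

(** Rescaling by [sigma] or its inverse translates between nonnegative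
coefficients and coefficients at least [(1 - sigma) / (n + 1)]. *)
Lemma dilateP sigma v x : 0 < sigma ->
  dilate sigma v x <->
  exists a, [/\ forall k, (1 - sigma) / n.+1%:R <= a k, \sum_k a k = 1
              & x = \sum_k a k *: v k].
Proof.
move=> s0; split=> [[_ [a [a0 a1] ->] <-]|[a [a0 a1 ->]]].
  exists (scale_coef sigma a); split; last exact: homothety_comb.
    by move=> k; rewrite scale_coef_ge.
  exact: scale_coef_sum.
have K k : scale_coef sigma (scale_coef sigma^-1 a) k = a k.
  by apply: scale_coefK; rewrite gt_eqF.
exists (\sum_k scale_coef sigma^-1 a k *: v k).
  exists (scale_coef sigma^-1 a) => //; split; last exact: scale_coef_sum.
  by move=> k; rewrite -(scale_coef_ge _ _ s0) K.
by rewrite homothety_comb; apply: eq_bigr => k _; rewrite K.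
Qed.

Lemma dilate_baryP sigma v x : nondegenerate_simplex v -> 0 < sigma ->
  dilate sigma v x <-> forall k, (1 - sigma) / n.+1%:R <= bary v x k.
Proof.
move=> nd s0; rewrite dilateP //; split=> [[a [a0 a1 xE]] k|b0].
  by rewrite -(bary_unique nd a1 xE).
by have [b1 b2] := bary_spec x nd; exists (bary v x).
Qed.

Lemma simplex_homothety sigma v :
  simplex (fun k => homothety (centroid v) sigma (v k)) = dilate sigma v.
Proof.
apply/seteqP; split=> [_ [a [a0 a1] ->]|_ [_ [a [a0 a1] ->] <-]].
  by exists (\sum_k a k *: v k); [exists a | rewrite comb_homothety].
by exists a => //; rewrite comb_homothety.
Qed.

Lemma nondegenerate_homothety c sigma v : sigma != 0 ->
  nondegenerate_simplex v ->
  nondegenerate_simplex (fun k => homothety c sigma (v k)).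
Proof.
move=> s0 nd a a1 a2; apply: nd => //; move: a2; rewrite /homothety.
under eq_bigr do rewrite scalerDr scalerA mulrC -scalerA scalerBr.
rewrite big_split /= -scaler_suml a1 scale0r add0r -scaler_sumr sumrB.
by rewrite -scaler_suml a1 scale0r subr0 => /eqP; rewrite scaler_eq0 (negbTE s0) => /eqP.
Qed.

(** A coordinate equal to [(1 - sigma) / (n + 1)] is one that vanishes before
the dilation, so the touching point lies on the corresponding face. *)
Lemma circumscribed_dilate sigma v (C : set 'rV[R]_n) :
  nondegenerate_simplex v -> 0 < sigma -> C `<=` dilate sigma v ->
  (forall j, exists2 x, C x & bary v x j = (1 - sigma) / n.+1%:R) ->
  circumscribed (dilate sigma v) C.
Proof.
move=> nd s0 CS touch.
exists (fun k => homothety (centroid v) sigma (v k)); split=> //.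
- by apply: nondegenerate_homothety; rewrite ?gt_eqF.
- by rewrite simplex_homothety.
move=> j; have [x Cx xj] := touch j; exists x; split=> //.
have [_ [a [a0 a1] ->] xE] := CS _ Cx.
exists a; last by rewrite comb_homothety.
split=> //; move: xj; rewrite -xE homothety_comb.
rewrite -(bary_unique nd (scale_coef_sum sigma a1) erefl) => aj.
have /eqP : sigma * a j = 0.
  by move: aj => /eqP; rewrite -subr_eq0 => /eqP <-; rewrite /scale_coef; ring.
by rewrite mulf_eq0 gt_eqF //= => /eqP.
Qed.

(** Moving such a point slightly away from the centroid makes the extremal
coordinate drop below its bound, so the point is not interior. *)
Lemma boundary_dilate sigma v x j :
  nondegenerate_simplex v -> 0 < sigma -> dilate sigma v x ->
  bary v x j = (1 - sigma) / n.+1%:R -> boundary (dilate sigma v) x.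
Proof.
move=> nd s0 Sx xj; split; first exact: subset_closure.
move=> xint; pose f (e : R) := x + e *: (x - centroid v).
have f0 : f 0 = x by rewrite /f scale0r addr0.
have fc : {for 0, continuous f}.
  apply: cvgD; first exact: cvg_cst.
  by apply: cvgZl; exact: cvg_id.
have : \forall e \near 0, dilate sigma v (f e).
  by apply: fc; rewrite f0; exact: xint.
move=> /nbhs_ballP[e /= e0 /(_ (e / 2))].
have e20 : 0 < e / 2 by rewrite divr_gt0.
(* The point f (e / 2) is the image of x under the homothety of
   coefficient 1 + e / 2. *)
have eball : ball (0 : R) e (e / 2).
  by rewrite /ball /= sub0r normrN gtr0_norm // ltr_pdivrMr // ltr_pMr // ltr1n.
move=> /(_ eball)/(dilate_baryP _ nd s0)/(_ j).
have [b1 b2] := bary_spec x nd.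
have fE : f (e / 2) = \sum_k scale_coef (1 + e / 2) (bary v x) k *: v k.
  by rewrite -homothety_comb b2 /homothety /f scalerDl scale1r addrA subrKC.
rewrite -(bary_unique nd (scale_coef_sum (1 + e / 2) b1) fE) /scale_coef xj.
rewrite leNgt => /negP; apply; rewrite -subr_gt0.
rewrite [X in 0 < X](_ : _ = e / 2 * sigma / n.+1%:R); last by ring.
by rewrite divr_gt0 ?ltr0Sn // mulr_gt0.
Qed.

End Barycentric.

(** * Dilations covering the cube *)

Section CubeCovering.
Variables (R : realType) (n : nat).
Implicit Types (v : 'I_n.+1 -> 'rV[R]_n) (x : 'rV[R]_n) (A : set R).

(** As the slopes sum to 0, weighting them by [2 x_i - 1] instead of [x_i] at the
vertices doubles the value 1 given by [slope_comb]; inside the cube these weights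
have absolute value at most 1. *)
Lemma slope_norm_sum v i : nondegenerate_simplex v ->
  simplex v `<=` cube R n -> 2 <= \sum_k `|slope v i k|.
Proof.
move=> nd vQ.
have e : \sum_k slope v i k * v k ord0 i = 1.
  move: (slope_comb i nd) => /rowP/(_ i); rewrite summxE [in RHS]mxE !eqxx => sE.
  by apply: etrans sE; apply: eq_bigr => k _; rewrite mxE.
have -> : 2 = \sum_k slope v i k * (2 * v k ord0 i - 1).
  under eq_bigr do rewrite mulrBr mulr1 mulrCA.
  by rewrite sumrB slope_sum // -mulr_sumr e subr0 mulr1.
apply: ler_sum => k _; apply: le_trans (ler_norm _) _.
rewrite normrM ler_piMr // ler_norml.
by have /andP[v0 v1] := vQ _ (vertex_in_simplex v k) i; apply/andP; split; lra.
Qed.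

(** Each barycentric coordinate is minimized over the cube at the corner chosen
by the signs of its slopes; the bound follows by adding these minima. *)
Lemma dilation_coef_ge v sigma : nondegenerate_simplex v ->
  simplex v `<=` cube R n -> 0 < sigma -> cube R n `<=` dilate sigma v ->
  n%:R <= sigma.
Proof.
move=> nd vQ s0 Qs.
pose corner k : 'rV[R]_n := \row_i (if slope v i k < 0 then 1 else 0).
have cornerQ k : cube R n (corner k).
  by move=> i; rewrite mxE; case: (_ < _); rewrite ?lexx ?ler01.
pose center : 'rV[R]_n := \row_i 2^-1.
have cornerE k : bary v (corner k) k =
    bary v center k - 2^-1 * \sum_i `|slope v i k|.
  rewrite (baryE v (corner k)) (baryE v center) -addrA; congr (_ + _).
  rewrite mulr_sumr -sumrB.
  apply: eq_bigr => i _; rewrite [corner k _ _]mxE [center _ _]mxE.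
  move: (slope v i k) => l.
  by case: (ltrP l 0) => h; [rewrite ltr0_norm // | rewrite ger0_norm //]; lra.
have : \sum_(k < n.+1) (1 - sigma) / n.+1%:R <= \sum_k bary v (corner k) k.
  by apply: ler_sum => k _; apply: (iffLR (dilate_baryP _ nd s0)) => //; exact: Qs.
rewrite sumr_const card_ord -[X in X <= _]mulr_natr divfK ?pnatr_eq0 //.
under eq_bigr do rewrite cornerE.
rewrite sumrB (bary_spec center nd).1 -mulr_sumr exchange_big /= => h.
have : \sum_(i < n) 2 <= \sum_(i < n) \sum_k `|slope v i k|.
  by apply: ler_sum => i _; exact: slope_norm_sum.
rewrite sumr_const card_ord -[X in X <= _]mulr_natr => h'.
lra.
Qed.

Lemma set_minE A m : A m -> lbound A m -> set_min A = m.
Proof.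
move=> Am mA; apply: xget_unique => // y [Ay yA].
by apply/eqP; rewrite eq_le yA //= mA.
Qed.

Lemma bary_bounded v k x : cube R n x ->
  bary v 0 k - \sum_i `|slope v i k| <= bary v x k.
Proof.
move=> xQ; rewrite (baryE v x) lerD2l -sumrN; apply: ler_sum => i _.
have /andP[x0 x1] := xQ i; rewrite lerNl; apply: le_trans (ler_norm _) _.
by rewrite normrN normrM ler_piMl // ger0_norm.
Qed.

(** The admissible coefficients are the upper bounds of a nonempty set of reals,
bounded because affine functions are bounded on the cube; its least upper bound
is the minimum sought. Without this the default value of [set_min] could
appear as a value of [xi]. *)
Lemma xi_attained v : nondegenerate_simplex v ->
  [/\ 1 <= xi v, cube R n `<=` dilate (xi v) v &
      forall sigma, 1 <= sigma -> cube R n `<=` dilate sigma v -> xi v <= sigma].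
Proof.
move=> nd.
pose F := [set y : R | y = 1 \/
  exists k x, cube R n x /\ y = 1 - n.+1%:R * bary v x k].
have FE sigma : (1 <= sigma /\ cube R n `<=` dilate sigma v) <-> ubound F sigma.
  split=> [[s1 Qs] y [->//|[k [x [xQ ->]]]]|ub].
    have /(dilate_baryP _ nd (lt_le_trans ltr01 s1))/(_ k) := Qs _ xQ.
    by rewrite ler_pdivrMr ?ltr0Sn // mulrC; lra.
  have s1 : 1 <= sigma by apply: ub; left.
  split=> // x xQ; apply/(dilate_baryP _ nd (lt_le_trans ltr01 s1)) => k.
  have : 1 - n.+1%:R * bary v x k <= sigma by apply: ub; right; exists k, x.
  by rewrite ler_pdivrMr ?ltr0Sn // mulrC; lra.
have F0 : F !=set0 by exists 1; left.
have Fub : has_ubound F.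
  pose B k := 1 - n.+1%:R * (bary v 0 k - \sum_i `|slope v i k|).
  exists (1 + \sum_k `|B k|) => y [->|[k [x [xQ ->]]]].
    by rewrite lerDl sumr_ge0.
  apply: (@le_trans _ _ (B k)); first by rewrite /B lerD2l lerN2 ler_wpM2l // bary_bounded.
  apply: le_trans (ler_norm _) _; rewrite (bigD1 k) //= addrCA lerDl.
  by rewrite addr_ge0 ?sumr_ge0.
have xiE : xi v = sup F.
  apply: set_minE; first by apply/FE; exact: ub_le_sup.
  by move=> sigma /FE; exact: ge_sup.
have [xi1 Qxi] : 1 <= xi v /\ cube R n `<=` dilate (xi v) v.
  by rewrite xiE; apply/FE; exact: ub_le_sup.
by split=> // sigma s1 Qs; rewrite xiE; apply: ge_sup => //; apply/FE.
Qed.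

Lemma xi_ge v : nondegenerate_simplex v -> simplex v `<=` cube R n ->
  n%:R <= xi v.
Proof.
move=> nd vQ; have [xi1 Qxi _] := xi_attained nd.
by apply: dilation_coef_ge Qxi => //; exact: lt_le_trans xi1.
Qed.

Lemma xi_min_eq v : (0 < n)%N -> nondegenerate_simplex v ->
  simplex v `<=` cube R n -> cube R n `<=` dilate n%:R v ->
  xi v = n%:R /\ xi_min R n = n%:R.
Proof.
move=> n0 nd vQ Qv; have [_ _ xi_le] := xi_attained nd.
have xiE : xi v = n%:R.
  by apply/eqP; rewrite eq_le xi_ge // andbT xi_le // ler1n.
split=> //; apply: set_minE.
  by exists v; split=> //; exact: simplex_vol_neq0.
by move=> _ [w [wnd wQ _ ->]]; exact: xi_ge.
Qed.

Lemma simplex_sub_cube v : (forall k, cube R n (v k)) -> simplex v `<=` cube R n.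
Proof.
move=> vQ _ [a [a0 a1] ->] i; rewrite summxE; apply/andP; split.
  by apply: sumr_ge0 => k _; rewrite mxE mulr_ge0 //; have /andP[] := vQ k i.
rewrite -a1; apply: ler_sum => k _.
by rewrite mxE ler_piMr //; have /andP[] := vQ k i.
Qed.

End CubeCovering.

(** * The simplex R(s, t) *)

Section SimplexR.
Variables (R : realType) (s t : R).
Implicit Types x : 'rV[R]_5.

(** The solution of the linear system that expresses [x] in the vertices of
[simplexR s t] (see [bary_simplexR]). *)
Definition baryR x (k : 'I_6) : R :=
  let c i := x ord0 (inord i) in
  [:: c 1%N - 2 / 3 + (2 - 3 * t) * c 3%N + (3 * t - 4 / 3) * c 4%N;
      1 / 3 - c 1%N + (3 * t - 1) * c 3%N + (5 / 3 - 3 * t) * c 4%N;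
      1 / 3 - c 3%N + 2 / 3 * c 4%N;
      1 - c 2%N - 2 / 3 * c 4%N;
      2 - 3 * s - c 0%N + (3 * s - 1) * c 2%N - (5 / 3 - 3 * s) * c 4%N;
      c 0%N - (2 - 3 * s) + (2 - 3 * s) * c 2%N - (3 * s - 4 / 3) * c 4%N]`_k.

Lemma nondegenerate_simplexR : nondegenerate_simplex (simplexR s t).
Proof.
move=> a a1 /rowP ae.
have e j : \sum_i a i * simplexR s t i ord0 j = 0.
  move: (ae j); rewrite summxE [in RHS]mxE => h.
  by apply: etrans h; apply: eq_bigr => i _; rewrite [RHS]mxE.
move: a1; rewrite !big_ord_recl big_ord0.
set d0 := a _; set d1 := a _; set d2 := a _.
set d3 := a _; set d4 := a _; set d5 := a _ => a1.
have := (e (inord 0), e (inord 1), e (inord 2), e (inord 3), e (inord 4)).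
rewrite !big_ord_recl !big_ord0 !mxE !inordK //= -/d0 -/d1 -/d2 -/d3 -/d4 -/d5.
case=> [[[[e0 e1] e2] e3] e4].
have d30 : d3 = 0 by lra.
have d20 : d2 = 0 by lra.
(* The first and the second coordinate equation involve s and t; there the
   groups of unknowns multiplied by s or t are replaced by their known values. *)
have d50 : d5 = 0.
  have -> : d5 = - s * (d0 + d1 + d2) - (2 - 3 * s) * d3 by lra.
  by rewrite (_ : d0 + d1 + d2 = 0) ?d30; lra.
have d00 : d0 = 0.
  have -> : d0 = - (2 - 3 * t) * d2 - t * (d3 + d4 + d5) by lra.
  by rewrite (_ : d3 + d4 + d5 = 0) ?d20; lra.
have d10 : d1 = 0 by lra.
have d40 : d4 = 0 by lra.
move: d00 d10 d20 d30 d40 d50; rewrite /d0 /d1 /d2 /d3 /d4 /d5.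
move=> d00 d10 d20 d30 d40 d50.
by case=> [[|[|[|[|[|[|k]]]]]] ltk] //;
  [rewrite -d00|rewrite -d10|rewrite -d20|rewrite -d30|rewrite -d40|rewrite -d50];
  congr (a _); exact: val_inj.
Qed.

Lemma bary_simplexR x k : bary (simplexR s t) x k = baryR x k.
Proof.
symmetry; apply: bary_unique; first exact: nondegenerate_simplexR.
  by rewrite !big_ord_recl big_ord0 /baryR /=; field.
apply/rowP => j; rewrite summxE; under eq_bigr do rewrite mxE [X in _ * X]mxE.
rewrite !big_ord_recl big_ord0 /baryR -[in LHS](inord_val j) /=.
by case: j => [[|[|[|[|[|j]]]]] ltj] //=; field.
Qed.

Hypotheses (hs : 4 / 9 <= s <= 5 / 9) (ht : 4 / 9 <= t <= 5 / 9).

Lemma simplexR_sub_cube : simplex (simplexR s t) `<=` cube R 5.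
Proof.
have /andP[s0 s1] := hs; have /andP[t0 t1] := ht.
apply: simplex_sub_cube => k j; rewrite mxE.
by case: k => [[|[|[|[|[|[|k]]]]]] ltk] //; case: j => [[|[|[|[|[|j]]]]] ltj] //=; lra.
Qed.

(** The coordinates are affine in [x], with slopes of constant sign because
[s] and [t] lie between [4 / 9] and [5 / 9]. *)
Lemma baryR_ge x k : cube R 5 x -> - (2 / 3) <= baryR x k.
Proof.
have /andP[s0 s1] := hs; have /andP[t0 t1] := ht.
move=> xQ; have c i : 0 <= x ord0 (inord i) <= 1 by exact: xQ.
rewrite /baryR; move: (c 0%N) (c 1%N) (c 2%N) (c 3%N) (c 4%N).
set x0 := x _ _; set x1 := x _ _; set x2 := x _ _; set x3 := x _ _; set x4 := x _ _.
move=> c0 c1 c2 c3 c4.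
have p (u w : R) : 0 <= u -> 0 <= w -> 0 <= u * w by exact: mulr_ge0.
(* Each coordinate, plus 2 / 3, is a nonnegative combination of these products
   and of the distances of x to the sides of the cube. *)
have := p (2 - 3 * t) x3; have := p (3 * t - 4 / 3) x4.
have := p (3 * t - 1) x3; have := p (5 / 3 - 3 * t) x4.
have := p (3 * s - 1) x2; have := p (5 / 3 - 3 * s) (1 - x4).
have := p (2 - 3 * s) x2; have := p (3 * s - 4 / 3) (1 - x4).
do 8 (move=> /(_ ltac:(lra) ltac:(lra)) ?).
by case: k => [[|[|[|[|[|[|k]]]]]] ltk] //=; lra.
Qed.

Lemma ratio_dilation5 : (1 - 5) / 6%:R = - (2 / 3) :> R.
Proof. by field. Qed.

Lemma cube_sub_dilate5 : cube R 5 `<=` dilate 5 (simplexR s t).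
Proof.
move=> x xQ; apply/(dilate_baryP _ nondegenerate_simplexR) => // k.
by rewrite ratio_dilation5 bary_simplexR; exact: baryR_ge.
Qed.

Lemma facet_touched k : exists2 x, cube R 5 x & baryR x k = - (2 / 3).
Proof.
pose w (l : seq R) : 'rV[R]_5 := \row_j l`_j.
pose x := w (nth [::] [:: [:: 0; 0; 0; 0; 0]; [:: 0; 1; 0; 0; 0];
  [:: 0; 0; 0; 1; 0]; [:: 0; 0; 1; 0; 1]; [:: 1; 0; 0; 0; 1];
  [:: 0; 0; 0; 0; 1]] k).
exists x.
  move=> j; rewrite mxE.
  by case: k @x => [[|[|[|[|[|[|k]]]]]] ltk] //; case: j => [[|[|[|[|[|j]]]]] ltj] //=; lra.
rewrite /baryR !mxE !inordK //.
by case: k @x => [[|[|[|[|[|[|k]]]]]] ltk] //=; field.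
Qed.

(** The six coordinates take the value [- 2 / 3] in turn on the faces of the cube
[x_2 = x_4 = x_5 = 0], [x_2 = 1, x_4 = x_5 = 0], [x_4 = 1, x_5 = 0],
[x_3 = x_5 = 1], [x_1 = 1, x_3 = 0, x_5 = 1] and [x_1 = x_3 = 0, x_5 = 1]
(coordinates numbered from 1), a decision tree through which every 0-1 vector
falls. *)
Lemma cube_vertex_facet x : cube_vertices R 5 x -> exists k, baryR x k = - (2 / 3).
Proof.
move=> xV; have c i := xV (inord i); rewrite /baryR.
case: (c 4%N) => c4.
  case: (c 3%N) => c3; last by exists (inord 2); rewrite inordK //= c3 c4; field.
  case: (c 1%N) => c1; first by exists (inord 0); rewrite inordK //= c1 c3 c4; field.
  by exists (inord 1); rewrite inordK //= c1 c3 c4; field.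
case: (c 2%N) => c2; last by exists (inord 3); rewrite inordK //= c2 c4; field.
case: (c 0%N) => c0; first by exists (inord 5); rewrite inordK //= c0 c2 c4; field.
by exists (inord 4); rewrite inordK //= c0 c2 c4; field.
Qed.

Lemma cube_vertices_boundary :
  cube_vertices R 5 `<=` boundary (dilate 5 (simplexR s t)).
Proof.
move=> x xV; have [k xk] := cube_vertex_facet xV.
apply: (@boundary_dilate _ _ _ _ _ k nondegenerate_simplexR) => //.
  by apply: cube_sub_dilate5 => j; case: (xV j) => ->; rewrite lexx ler01.
by rewrite bary_simplexR ratio_dilation5.
Qed.

End SimplexR.

Theorem mainTheorem3 (R : realType) (s t : R)
    (hs : 4 / 9 <= s <= 5 / 9) (ht : 4 / 9 <= t <= 5 / 9) :
  [/\ nondegenerate_simplex (simplexR s t),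
      simplex (simplexR s t) `<=` cube R 5 /\
      cube R 5 `<=` dilate 5 (simplexR s t),
      xi (simplexR s t) = xi_min R 5 /\ xi_min R 5 = 5,
      circumscribed (dilate 5 (simplexR s t)) (cube R 5)
    & cube_vertices R 5 `<=` boundary (dilate 5 (simplexR s t))]
  /\ perfect_simplex (simplexR s t).
Proof.
have nd := @nondegenerate_simplexR R s t.
have SQ := simplexR_sub_cube hs ht.
have QS := cube_sub_dilate5 hs ht.
have bd := cube_vertices_boundary hs ht.
have [xiE xi_minE] := xi_min_eq (n := 5) isT nd SQ QS.
split; last by split; rewrite ?xi_minE.
split=> //; first by rewrite xiE xi_minE.
apply: circumscribed_dilate => // k.
have [x xQ xk] := facet_touched s t k.
by exists x; rewrite // bary_simplexR xk ratio_dilation5.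
Qed.
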